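(* Let $\pi$ be a measure preserving action of an amenable topological group $G$ on a probability space $(X,\mu)$. If $G$ contains an infinite precompact subset, then $\operatorname{E}_\mu^{(Oll)}(\pi)=0$.
   Context: Topological groups are assumed Hausdorff. A topological group $G$ is amenable if every continuous action of $G$ on a non-empty compact Hausdorff space admits an invariant regular Borel probability measure; equivalently, $G$ admits a thin Følner net as defined below. A subset $A\subseteq G$ is precompact if for every neighbourhood $U$ of the neutral element there is a finite $F\subseteq G$ with $A\subseteq UF$. An action $\pi$ of a topological group $G$ on a probability space $(X,\mu)$, written $\pi^g(x)=g.x$, is measure preserving if (1) $\pi^g$ is measurable for every $g\in G$; (2) $\mu(g.A)=\mu(A)$ for all $g\in G$ and measurable $A\subseteq X$; (3) for every measurable $A\subseteq X$ the map $g\mapsto\mu(A\triangle g.A)$ is continuous on $G$. For finite $E,F\subseteq G$ and a neighbourhood $U$ of the neutral element, let $\operatorname{match}(E,F,U)$ be the maximal cardinality of a subset $M\subseteq E$ for which there is an injection $\iota\colon M\to F$ with $x\,\iota(x)^{-1}\in U$ for all $x\in M$. A net $(F_i)_{i\in I}$ of non-empty finite subsets of $G$ is a thin Følner net if $\operatorname{match}(F_i,gF_i,U)/|F_i|\to1$ for every such $U$ and every $g\in G$. For a finite measurable partition $\alpha$ of $X$ put $H_\mu(\alpha)=-\sum_{A\in\alpha,\ \mu(A)>0}\mu(A)\log\mu(A)$, and for finite $F\subseteq G$ let $\alpha_F=\{\bigcap_{g\in F}g^{-1}.A(g)\mid A\in\alpha^F\}$. The Ollagnier entropy is $\operatorname{E}_\mu^{(Oll)}(\pi)=\sup_\alpha\lim_{i\in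 I}H_\mu(\alpha_{F_i})/|F_i|$, the supremum over all finite measurable partitions $\alpha$ of $X$, where $(F_i)_{i\in I}$ is a thin Følner net in $G$ (the limit exists and does not depend on the choice of the thin Følner net). *)

(* Defs.v *)
From HB Require Import structures.
From mathcomp Require Import all_boot all_order all_algebra.
From mathcomp Require Import finmap.
From mathcomp Require Import all_classical all_reals all_analysis.

Set Implicit Arguments.
Unset Strict Implicit.
Unset Printing Implicit Defensive.

Import Order.TTheory GRing.Theory Num.Theory.
Import numFieldNormedType.Exports.

Local Open Scope classical_set_scope.
Local Open Scope ring_scope.

HB.mixin Record Group_Topological_isTopologicalGroup G
    of Group G & Topological G := {
  mulg_continuous : continuous (fun xy : G * G => (xy.1 * xy.2)%g);
  invg_continuous : continuous (fun x : G => (x^-1)%g)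
}.

(* The Hausdorff axiom is not part of the structure. *)
#[short(type="topologicalGroupType")]
HB.structure Definition TopologicalGroup :=
  {G of Group G & Topological G & Group_Topological_isTopologicalGroup G}.

(* Precompactness in the group uniformity; the library's [precompact] is a
   different, purely topological notion. *)
Definition group_precompact (G : topologicalGroupType) (A : set G) : Prop :=
  forall U : set G, nbhs (1%g : G) U ->
    exists F : {fset G},
      A `<=` [set x | exists u f, [/\ U u, f \in F & x = (u * f)%g]].

Definition group_action (G : groupType) (T : Type) (pi : G -> T -> T) : Prop :=
  (forall x, pi 1%g x = x) /\
  (forall g h x, pi (g * h)%g x = pi g (pi h x)).

Definition continuous_action (G : topologicalGroupType) (Y : topologicalType)
    (pi : G -> Y -> Y) : Prop :=
  group_action pi /\ continuous (fun gy : G * Y => pi gy.1 gy.2).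

Definition regular_measure (R : realType) (Y : ptopologicalType)
    (nu : probability (g_sigma_algebraType (@open Y)) R) : Prop :=
  forall B : set Y, <<s @open Y >> B ->
    nu B = ereal_inf [set nu V | V in [set V : set Y | open V /\ B `<=` V]] /\
    nu B = ereal_sup [set nu K | K in [set K : set Y | compact K /\ K `<=` B]].

(* Non-emptiness of the compact space is the point of [ptopologicalType];
   its Borel sigma-algebra is the one generated by the open sets. *)
Definition amenable (R : realType) (G : topologicalGroupType) : Prop :=
  forall (Y : ptopologicalType) (pi : G -> Y -> Y),
    compact [set: Y] -> hausdorff_space Y -> continuous_action pi ->
    exists nu : probability (g_sigma_algebraType (@open Y)) R,
      regular_measure nu /\
      forall (g : G) (B : set Y), <<s @open Y >> B -> nu (pi g @` B) = nu B.

Definition measure_preserving_action (G : topologicalGroupType)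
    (R : realType) (d : measure_display) (X : measurableType d)
    (mu : probability X R) (pi : G -> X -> X) : Prop :=
  [/\ group_action pi,
      forall g : G, measurable_fun [set: X] (pi g),
      forall (g : G) (A : set X), measurable A -> mu (pi g @` A) = mu A &
      forall A : set X, measurable A ->
        continuous (fun g : G => mu (A `+` (pi g @` A)))].

(* The largest cardinality of a subset M of E admitting an injection
   iota : M -> F with x * (iota x)^-1 in U; the values of iota outside M are
   irrelevant, and M = fset0 always qualifies. *)
Definition matching_number (G : topologicalGroupType) (E F : {fset G})
    (U : set G) : nat :=
  (\max_(M <- fpowerset E | `[< exists iota : G -> G,
      [/\ {in M &, injective iota},
          {in M, forall x, iota x \in F} &
          {in M, forall x, U (x * (iota x)^-1)%g}] >]) #|` M |)%N.

Record directed (I : Type) (le : I -> I -> Prop) : Prop := {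
  directed_inhabited : inhabited I;
  directed_refl : forall i, le i i;
  directed_trans : forall i j k, le i j -> le j k -> le i k;
  directed_upper : forall i j, exists k, le i k /\ le j k
}.

(* Convergence of a net indexed by (I, le) is convergence along this filter. *)
Definition tails (I : Type) (le : I -> I -> Prop) : set_system I :=
  filter_from [set: I] (fun i => [set j | le i j]).

Definition thin_folner_net (R : realType) (G : topologicalGroupType)
    (I : Type) (le : I -> I -> Prop) (F : I -> {fset G}) : Prop :=
  [/\ directed le,
      forall i, F i != fset0 &
      forall (U : set G) (g : G), nbhs (1%g : G) U ->
        (matching_number (F i) [fset (g * x)%g | x in F i]%fset U)%:R
          / #|` F i |%:R @[i --> tails le] --> (1 : R)].

Section Entropy.
Context {G : topologicalGroupType} {R : realType} {d : measure_display}
  {X : measurableType d}.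
Implicit Types (mu : probability X R) (pi : G -> X -> X)
  (alpha : set (set X)).

Definition finite_measurable_partition alpha : Prop :=
  [/\ finite_set alpha, alpha `<=` measurable & partition alpha id [set: X]].

Definition partition_entropy mu alpha : R :=
  - \sum_(A \in alpha `&` [set A | (0 < mu A)%E])
      (fine (mu A) * ln (fine (mu A))).

(* Choice functions in alpha^F are represented by total functions G -> set X
   whose values outside F play no role. *)
Definition refined_partition pi alpha (F : {fset G}) : set (set X) :=
  [set \bigcap_(g in [set` F]) (pi (g^-1)%g @` A g) |
     A in [set A : G -> set X | forall g, g \in F -> alpha (A g)]].

Definition normalized_entropy mu pi alpha (F : {fset G}) : R :=
  partition_entropy mu (refined_partition pi alpha F) / #|` F |%:R.

(* [lim] is only meaningful when the limit exists. *)
Definition ollagnier_entropy (I : Type) (le : I -> I -> Prop)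
    (F : I -> {fset G}) mu pi : \bar R :=
  ereal_sup [set (lim (normalized_entropy mu pi alpha (F i)
                       @[i --> tails le]))%:E |
               alpha in finite_measurable_partition].

End Entropy.

(* Main.v *)
(* An infinite precompact set makes every neighbourhood of 1 infinite, and this
   alone forces the entropy to vanish.  Let W be a neighbourhood of 1 moving
   each block of the partition by little, and take N distinct elements a of a
   small neighbourhood V.  If C is a maximal W-separated subset of F_i, then for
   most c in C and all a the Følner condition gives points of F_i of the form
   a u^-1 c with u close to 1.  These are pairwise distinct, so |C| is at most
   about |F_i| / N, while every g in F_i is W-close to some c in C, so that the
   letter of a word at g is, with high probability, the letter at c.  Coding the
   letters at C uniformly and the others through a noisy channel bounds the
   entropy by |C| log k plus a small multiple of |F_i|. *)
Require Import Defs.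
From mathcomp Require Import all_boot all_order all_algebra.
From mathcomp Require Import finmap.
From mathcomp Require Import all_classical all_reals all_analysis.
From mathcomp Require Import ring lra.

Set Implicit Arguments.
Unset Strict Implicit.
Unset Printing Implicit Defensive.

Import Order.TTheory GRing.Theory Num.Theory.
Import numFieldNormedType.Exports.

Local Open Scope classical_set_scope.
Local Open Scope ring_scope.

(** * Entropy bounds from code lengths *)

(** Termwise, [1 + t <= expR t] at [t = - f x - ln (p x)] bounds [- p ln p] by [p f] plus the
    correction [expR (- f) - p], and the corrections have sum at most 0. *)
Lemma gibbs_inequality (R : realType) (T : finType) (p f : T -> R) :
  (forall x, 0 <= p x) -> \sum_x p x = 1 -> \sum_x expR (- f x) <= 1 ->
  - (\sum_x p x * ln (p x)) <= \sum_x p x * f x.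
Proof.
move=> p0 p1 f1; rewrite -sumrN.
suff : \sum_x - (p x * ln (p x)) <=
    \sum_x (p x * f x + (expR (- f x) - p x)).
  rewrite big_split/= sumrB p1 => h; lra.
apply: ler_sum => x _; have := p0 x; rewrite le_eqVlt => /predU1P[<-|px].
  by rewrite !mul0r oppr0 add0r addr0 expR_ge0.
have := expR_ge1Dx (- f x - ln (p x)).
rewrite expRD [expR (- ln _)]expRN lnK ?posrE// ler_pdivlMr// => h.
lra.
Qed.

(* Reading the word [w] off a coarse word on [D] through a noisy channel that
   costs [eps] per correct letter and [lam] per wrong letter gives the
   subprobability of the Gibbs inequality. *)
Lemma entropy_coding_bound (R : realType) (F D L : finType)
    (c : F -> D) (s : D -> F) (p : {ffun F -> L} -> R) (eps lam : R) :
  (forall w, 0 <= p w) -> \sum_w p w = 1 ->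
  0 <= eps -> (0 < #|L|)%N -> expR (- eps) + #|L|%:R * expR (- lam) <= 1 ->
  - (\sum_w p w * ln (p w)) <=
    #|D|%:R * ln #|L|%:R + #|F|%:R * eps +
    lam * \sum_g \sum_(w : {ffun F -> L} | w g != w (s (c g))) p w.
Proof.
move=> p0 p1 eps0 L0 hL.
pose K (a b : L) := if a == b then eps else lam.
(* Code length of [w]: a uniform code for its restriction along [s], then the channel cost of every
   letter given that restriction. *)
pose f (w : {ffun F -> L}) :=
  #|D|%:R * ln #|L|%:R + \sum_g K (w g) (w (s (c g))).
have L0' : (0 : R) < #|L|%:R by rewrite ltr0n.
have K1 b : \sum_a expR (- K a b) <= 1.
  rewrite (bigD1 b)//= {1}/K eqxx; apply: le_trans hL; rewrite lerD2l.
  rewrite mulr_natl -sumr_const [leRHS](bigD1 b)//= -[leLHS]add0r lerD ?expR_ge0//.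
  by apply: ler_sum => a /negPf ab; rewrite /K ab.
have f1 : \sum_w expR (- f w) <= 1.
  (* Joint weight of a uniform coarse word [v] and a channel output [w]; [expR (- f w)] is its
     single term at [v = w \o s], so summing over all [v] only increases it. *)
  pose q (v : {ffun D -> L}) (w : {ffun F -> L}) :=
    #|L|%:R ^- #|D| * \prod_g expR (- K (w g) (v (c g))).
  have q0 v w : 0 <= q v w.
    by rewrite mulr_ge0 ?invr_ge0 ?exprn_ge0 ?(ltW L0')// prodr_ge0// => *;
      rewrite expR_ge0.
  apply: (@le_trans _ _ (\sum_w \sum_v q v w)).
    apply: ler_sum => w _; rewrite (bigD1 [ffun x => w (s x)])//=.
    rewrite -[leLHS]addr0 lerD ?sumr_ge0//.
    rewrite /q /f opprD expRD -mulrN -sumrN expR_sum mulrN expRN mulrC.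
    rewrite expRM_natl lnK ?posrE// mulrC.
    under [X in _ <= _ * X]eq_bigr do rewrite ffunE.
    exact: lexx.
  rewrite exchange_big/=.
  apply: (@le_trans _ _ (\sum_(v : {ffun D -> L}) #|L|%:R ^- #|D|)).
    apply: ler_sum => v _; rewrite -mulr_sumr ler_piMr ?invr_ge0 ?exprn_ge0 ?(ltW L0')//.
    (* For fixed [v] the letters are independent: the sum over words is a product of letter sums,
       each at most 1 by [K1]. *)
    rewrite -(bigA_distr_bigA (fun g a => expR (- K a (v (c g)))))/=.
    apply: prodr_ile1 => g _; rewrite K1 andbT sumr_ge0// => ? _; exact: expR_ge0.
  by rewrite sumr_const card_ffun -[leLHS]mulr_natr natrX mulVf// expf_neq0// gt_eqF.
apply: (le_trans (gibbs_inequality p0 p1 f1)).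
rewrite (eq_bigr (fun w => p w * (#|D|%:R * ln #|L|%:R) +
   \sum_g p w * K (w g) (w (s (c g))))); last first.
  by move=> w _; rewrite mulrDr mulr_sumr.
rewrite big_split/= -mulr_suml p1 mul1r -addrA lerD2l exchange_big/=.
rewrite mulr_natl -sumr_const mulr_sumr -big_split/=.
apply: ler_sum => g _.
rewrite [X in _ <= X + _](_ : _ = \sum_w p w * eps); last first.
  by rewrite -mulr_suml p1 mul1r.
rewrite mulr_sumr [X in _ <= _ + X]big_mkcond/= -big_split/=.
apply: ler_sum => w _; rewrite /K; case: eqP => _ /=; first by rewrite addr0.
by rewrite mulrC lerDr mulr_ge0.
Qed.

(** * Neighbourhoods of the neutral element *)

Lemma nbhs1_mulV (G : topologicalGroupType) (W : set G) :
  nbhs (1%g : G) W -> exists V : set G, nbhs (1%g : G) V /\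
    forall x y, V x -> V y -> W (x * y^-1)%g /\ W (x^-1 * y)%g.
Proof.
move=> W1.
have c1 : continuous (fun xy : G * G => (xy.1 * xy.2^-1)%g).
  move=> z; apply: (continuous_comp (g := fun xy : G * G => (xy.1 * xy.2)%g)
    (f := fun xy : G * G => (xy.1, (xy.2^-1)%g))); last exact: mulg_continuous.
  by apply: cvg_pair; [exact: cvg_fst|
    apply: (cvg_comp _ _ cvg_snd); exact: invg_continuous].
have c2 : continuous (fun xy : G * G => (xy.1^-1 * xy.2)%g).
  move=> z; apply: (continuous_comp (g := fun xy : G * G => (xy.1 * xy.2)%g)
    (f := fun xy : G * G => ((xy.1^-1)%g, xy.2))); last exact: mulg_continuous.
  by apply: cvg_pair; [
    apply: (cvg_comp _ _ cvg_fst); exact: invg_continuous|exact: cvg_snd].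
have [|[A1 B1] [/= A11 B11] AB1] := c1 (1%g, 1%g) W; first by rewrite /= invg1 mulg1.
have [|[A2 B2] [/= A21 B21] AB2] := c2 (1%g, 1%g) W; first by rewrite /= invg1 mulg1.
exists ((A1 `&` B1) `&` (A2 `&` B2)); split.
  by do 2! apply: filterI; rewrite //=; exact: filterI.
move=> x y [[xA1 xB1] [xA2 xB2]] [[yA1 yB1] [yA2 yB2]].
by split; [apply: (AB1 (x, y))|apply: (AB2 (x, y))]; split.
Qed.

(** If [V] were finite, [A] would lie in the finite product of [V] with a finite set. Only this
    consequence of the existence of [A] is used later. *)
Lemma precompact_nbhs_infinite (G : topologicalGroupType) (A V : set G) :
  infinite_set A -> group_precompact A -> nbhs (1%g : G) V -> infinite_set V.
Proof.
move=> infA preA V1 finV; apply: infA; have [K AK] := preA _ V1.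
apply: (sub_finite_set (B := (fun xy : G * G => (xy.1 * xy.2)%g) @` (V `*` [set` K]))).
  by move=> x /AK[u [f [Vu fK ->]]]; exists (u, f).
by apply: finite_image; apply: finite_setX => //; exact: finite_fset.
Qed.

(** The finitely many quotients [b^-1 a] other than 1 form a closed set, so some [U] has no [v^-1 u]
    among them; [a u^-1 = b v^-1] means [b^-1 a = v^-1 u]. *)
Lemma hausdorff_separating_nbhs (G : topologicalGroupType) (B : {fset G}) :
  hausdorff_space G -> exists U : set G, nbhs (1%g : G) U /\
    forall a b u v, a \in B -> b \in B -> U u -> U v ->
      (a * u^-1 = b * v^-1)%g -> a = b.
Proof.
move=> hG.
pose D := ((fun xy : G * G => (xy.2^-1 * xy.1)%g) @` ([set` B] `*` [set` B])) `\ 1%g.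
have finD : finite_set D.
  apply: finite_setD; apply: finite_image.
  by apply: finite_setX; exact: finite_fset.
have D1 : nbhs (1%g : G) (~` D).
  apply: open_nbhs_nbhs; split; last by case=> _; apply.
  apply: closed_openC; have [h _] := @accessible_finite_set_closed G.
  by apply: h => //; exact: hausdorff_accessible.
have [U [U1 UD]] := nbhs1_mulV D1.
exists U; split=> // a b u v aB bB Uu Uv abuv.
have ba : (b^-1 * a = v^-1 * u)%g.
  by apply: (@mulIg _ u^-1%g); rewrite -mulgA abuv mulgA mulVg mul1g mulgK.
apply: contrapT => ab; have [_] := UD _ _ Uv Uu; rewrite -ba; apply.
split; first by exists (a, b).
move=> /= /(congr1 (fun x => b * x)%g); rewrite mulVKg mulg1; exact: ab.
Qed.

(** * Matchings and separated subsets of a finite set *)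

Lemma matching_numberP (G : topologicalGroupType) (E F : {fset G}) (U : set G) :
  exists M : {fset G}, [/\ (M `<=` E)%fset, #|` M| = matching_number E F U &
    exists iota : G -> G, [/\ {in M &, injective iota},
      {in M, forall x, iota x \in F} & {in M, forall x, U (x * (iota x)^-1)%g}]].
Proof.
rewrite /matching_number big_seq_cond.
apply: (big_ind (fun n => exists M : {fset G}, [/\ (M `<=` E)%fset, #|` M| = n &
    exists iota : G -> G, [/\ {in M &, injective iota},
      {in M, forall x, iota x \in F} & {in M, forall x, U (x * (iota x)^-1)%g}]])).
- exists fset0; split; [exact: fsub0set|exact: cardfs0|].
  by exists id; split=> x; rewrite inE.
- move=> m n hm hn; rewrite /maxn; case: ifP => _; [exact: hn|exact: hm].
- by move=> M /andP[]; rewrite fpowersetE => ME /asboolP h; exists M.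
Qed.

(** Greedy construction: a new point joins [C] only when [C] does not cover it yet. Symmetry of [W]
    makes separation independent of the order of the two points. *)
Lemma exists_separated_fset (G : groupType) (W : set G) (F : {fset G}) :
  W 1%g -> (forall x, W x -> W x^-1%g) ->
  exists C : {fset G}, [/\ (C `<=` F)%fset,
    forall c c', c \in C -> c' \in C -> W (c * c'^-1)%g -> c = c' &
    forall g, g \in F -> exists2 c, c \in C & W (g * c^-1)%g].
Proof.
move=> W1 WV; elim/fset1U_rect: F => [|x F xF [C [CF sepC covC]]].
  by exists fset0; split.
have [[c cC Wxc]|nx] := pselect (exists2 c, c \in C & W (x * c^-1)%g).
  exists C; split => //; first exact: fsubset_trans CF (fsubsetU1 _ _).
  by move=> g /fset1UP[->|/covC//]; exists c.
have nxC c : c \in C -> ~ W (x * c^-1)%g by move=> cC Wxc; apply: nx; exists c.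
exists (x |` C)%fset; split; first exact: fsetUS.
- move=> c c' /fset1UP[->|cC] /fset1UP[->|c'C] //.
  + by move/nxC.
  + by move/WV; rewrite invgM invgK => /nxC.
  + exact: sepC.
- move=> g /fset1UP[->|/covC[c cC Wgc]].
    by exists x; rewrite ?fset1U1 ?mulgV.
  by exists c => //; rewrite fset1Ur.
Qed.

Lemma sum_card_disjoint_le (I T : choiceType) (s : seq I) (A : I -> {fset T})
    (F : {fset T}) :
  uniq s -> (forall i, i \in s -> (A i `<=` F)%fset) ->
  (forall i j x, i \in s -> j \in s -> x \in A i -> x \in A j -> i = j) ->
  (\sum_(i <- s) #|` A i| <= #|` F|)%N.
Proof.
elim: s F => [|i s IHs] F; first by rewrite big_nil.
move=> /= /andP[is_ us] AF Aij; rewrite big_cons.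
have AiF : (A i `<=` F)%fset by apply: AF; rewrite mem_head.
rewrite -(cardfsID (A i) F) (fsetIidPr AiF) leq_add2l; apply: IHs => //.
  move=> j js; apply/fsubsetP => x xAj; rewrite inE.
  have jis : j \in i :: s by rewrite inE js orbT.
  rewrite (fsubsetP (AF _ jis))// andbT; apply/negP => xAi.
  by move: is_; rewrite (Aij i j x) ?mem_head ?js.
by move=> j k x js ks; apply: Aij; rewrite inE ?js ?ks orbT.
Qed.

(* The translates [a u^-1 c], over the [c] matched along [a^-1 F], are pairwise
   distinct elements of [F]. *)
Lemma separated_card_le (G : topologicalGroupType) (F C B : {fset G})
    (U W : set G) :
  (C `<=` F)%fset ->
  (forall c c', c \in C -> c' \in C -> W (c * c'^-1)%g -> c = c') ->
  (forall a b u v, a \in B -> b \in B -> U u -> U v ->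
    W ((a * u^-1)^-1 * (b * v^-1))%g) ->
  (forall a b u v, a \in B -> b \in B -> U u -> U v ->
    (a * u^-1 = b * v^-1)%g -> a = b) ->
  (#|` C| * #|` B| <= #|` F| + \sum_(a <- B)
    (#|` F| - matching_number F [fset (a^-1 * x)%g | x in F]%fset U))%N.
Proof.
move=> CF sepC WB sepB.
have /choice[M hM] a := matching_numberP F [fset (a^-1 * x)%g | x in F]%fset U.
have /choice[iota hi] : forall a, exists iota : G -> G,
    {in M a, forall x, (a * iota x)%g \in F /\ U (x * (iota x)^-1)%g}.
  move=> a; have [_ _ [f [_ fF fU]]] := hM a; exists f => x xM; split; last exact: fU.
  by have /imfsetP[y yF ->] := fF x xM; rewrite mulVKg.
have key a b c c' : a \in B -> b \in B -> c \in (C `&` M a)%fset ->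
    c' \in (C `&` M b)%fset -> (a * iota a c = b * iota b c')%g -> c = c' /\ a = b.
  move=> aB bB /fsetIP[cC /hi[_]] + /fsetIP[c'C /hi[_]] +.
  set u := (c * _)%g; set v := (c' * _)%g => Uu Uv.
  (* The matching displaces [c] by [u] in [U], so the translate is [a u^-1 c]. *)
  have -> : iota a c = (u^-1 * c)%g by rewrite /u invgM invgK mulgVK.
  have -> : iota b c' = (v^-1 * c')%g by rewrite /v invgM invgK mulgVK.
  rewrite !mulgA => e.
  (* From [a u^-1 c = b v^-1 c'], the quotient [c c'^-1] equals [(a u^-1)^-1 (b v^-1)], which lies
     in [W]; separation applies. *)
  have cc' : c = c'.
    apply: sepC => //; rewrite [(c * _)%g](_ : _ = (a * u^-1)^-1 * (b * v^-1))%g.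
      exact: WB.
    by apply: (@mulIg _ c'); rewrite mulgVK -mulgA -e mulKg.
  split=> //; apply: (sepB _ _ u v) => //; apply: (@mulIg _ c).
  by rewrite e cc'.
have h : (\sum_(a <- B) #|` (C `&` M a)%fset| <= #|` F|)%N.
  rewrite (_ : \sum_(a <- B) _ = \sum_(a <- B)
      #|` [fset (a * iota a c)%g | c in (C `&` M a)%fset]%fset|)%N; last first.
    rewrite !big_seq; apply: eq_bigr => a aB; rewrite [RHS]card_in_imfset//.
    by move=> c c' cC c'C /(key a a _ _ aB aB cC c'C)[].
  apply: sum_card_disjoint_le; first exact: fset_uniq.
    move=> a aB; apply/fsubsetP => _ /imfsetP[c /fsetIP[_ cM] ->].
    by have [] := hi a c cM.
  move=> a b _ aB bB /imfsetP[c cC ->] /imfsetP[c' c'C e].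
  by have [] := key a b c c' aB bB cC c'C e.
apply: leq_trans (leq_add h (leqnn _)).
(* For each [a], the points of [C] outside [M a] are among the unmatched points of [F]. *)
rewrite mulnC -sum1_size big_distrl/= -big_split/=.
apply: leq_sum => a _; rewrite mul1n.
have [MF <- _] := hM a.
rewrite -(cardfsID (M a) C) leq_add2l -cardfsDS//.
by apply: fsubset_leq_card; apply: fsetSD.
Qed.

(** * Small covers of thin Følner sets *)

Lemma tails_proper_filter (I : Type) (le : I -> I -> Prop) :
  directed le -> ProperFilter (tails le).
Proof.
move=> [[i0] refl trans upper]; apply: filter_from_proper; last first.
  by move=> i _; exists i; exact: refl.
apply: filter_from_filter; first by exists i0.
move=> i j _ _; have [k [ik jk]] := upper i j; exists k => // l kl.
by split; exact: trans kl.
Qed.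

(** Counting translates gives [|C| |B| <= |F| + |B| (delta / 2) |F|] once every [a] in [B] leaves at
    most [(delta / 2) |F|] points unmatched; taking [|B| > 2 / delta] and dividing by [|B|]
    suffices. *)
Lemma thin_folner_small_cover (R : realType) (G : topologicalGroupType)
    (A : set G) (I : Type) (le : I -> I -> Prop) (F : I -> {fset G}) :
  hausdorff_space G -> infinite_set A -> group_precompact A ->
  thin_folner_net R le F ->
  forall (W : set G) (delta : R), nbhs (1%g : G) W -> 0 < delta ->
  \forall i \near tails le, exists C : {fset G}, [/\ (C `<=` F i)%fset,
    #|` C|%:R <= delta * #|` F i|%:R &
    forall g, g \in F i -> exists2 c, c \in C & W (g * c^-1)%g].
Proof.
move=> hG infA preA [dle F0 matchF] W delta W1 delta0.
have ptails := tails_proper_filter dle.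
pose W' := W `&` (fun x : G => (x^-1)%g) @^-1` W.
have W'1 : nbhs (1%g : G) W'.
  by apply: filterI => //; apply: invg_continuous; rewrite invg1.
(* Two successive shrinkings: elements [a u^-1] from [V2] land in [V1], and quotients of these land
   in [W']. *)
have [V1 [V11 V1W]] := nbhs1_mulV W'1.
have [V2 [V21 V2V]] := nbhs1_mulV V11.
have [B BV cardB] := infinite_set_fset (Num.truncn (2 / delta)).+1
  (precompact_nbhs_infinite infA preA V21).
have [U0 [U01 sepU]] := hausdorff_separating_nbhs B hG.
pose U := U0 `&` V2.
have U1 : nbhs (1%g : G) U by exact: filterI.
have near_match : \forall i \near tails le, forall a, a \in B ->
    1 - delta / 2 < (matching_number (F i) [fset (a^-1 * x)%g | x in F i]%fset U)%:R
          / #|` F i |%:R.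
  have h : tails le (\bigcap_(a in [set` B]) [set i | 1 - delta / 2 <
      (matching_number (F i) [fset (a^-1 * x)%g | x in F i]%fset U)%:R
        / #|` F i |%:R :> R]).
    apply: filter_bigI => a aB.
    by apply: (cvgr_gt _ (matchF U a^-1%g U1)); rewrite ltrBlDr ltrDl divr_gt0.
  by apply: filterS h => i hi a aB; exact: hi.
apply: filterS near_match => i mi.
have W'V x : W' x -> W' x^-1%g by case=> Wx WVx; split; rewrite //= invgK.
have [C [CF sepC covC]] := exists_separated_fset (F i) (nbhs_singleton W'1) W'V.
exists C; split=> //; last by move=> g /covC[c cC [Wgc _]]; exists c.
have WB a b u v : a \in B -> b \in B -> U u -> U v ->
    W' ((a * u^-1)^-1 * (b * v^-1))%g.
  move=> aB bB [_ V2u] [_ V2v].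
  have [+ _] := V2V a u (BV _ aB) V2u; have [+ _] := V2V b v (BV _ bB) V2v.
  by move=> h1 h2; have [] := V1W _ _ h2 h1.
have sepB a b u v : a \in B -> b \in B -> U u -> U v ->
    (a * u^-1 = b * v^-1)%g -> a = b.
  by move=> aB bB [U0u _] [U0v _]; exact: sepU.
have Fi0 : (0 : R) < #|` F i|%:R by rewrite ltr0n cardfs_gt0.
have B0 : (0 : R) < #|` B|%:R by rewrite ltr0n (leq_trans _ cardB).
have dB : 2 / delta < #|` B|%:R.
  apply: (@lt_le_trans _ _ (Num.truncn (2 / delta)).+1%:R); last by rewrite ler_nat.
  exact: truncnS_gt.
rewrite -(ler_pM2r B0).
have := separated_card_le CF sepC WB sepB.
rewrite -(ler_nat R) natrM natrD => /le_trans; apply.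
have -> : delta * #|` F i|%:R * #|` B|%:R =
   delta * #|` B|%:R / 2 * #|` F i|%:R + delta / 2 * #|` F i|%:R * #|` B|%:R by field.
apply: lerD.
  rewrite ler_peMl ?(ltW Fi0)// ler_pdivlMr// mul1r.
  by move: dB; rewrite ltr_pdivrMr// mulrC => /ltW.
rewrite -(sum1_size B) !natr_sum mulr_sumr.
rewrite big_seq [leRHS]big_seq; apply: ler_sum => a aB; rewrite mulr1.
have := mi a aB; set m := matching_number _ _ _; rewrite ltr_pdivlMr// => hm.
(* The subtraction is truncated in [nat]: it is 0 in the first case and genuine in the second. *)
have [Fm|mF] := leqP #|` F i| m.
  by rewrite (eqP Fm) mulr_ge0 ?divr_ge0// ltW.
by rewrite natrB ?(ltnW mF)//; lra.
Qed.

(** * Refined partitions as distributions on words *)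

Lemma fsbig_finType (V : Type) (idx : V) (op : Monoid.com_law idx) (T : finType)
    (P : pred T) (f : T -> V) :
  \big[op/idx]_(i \in [set` P]) f i = \big[op/idx]_(i | P i) f i.
Proof.
rewrite -(@bigfs _ _ _ _ (index_enum T))//; first exact: index_enum_uniq.
by move=> i _; rewrite mem_index_enum.
Qed.

Section RefinedPartition.
Context {G : topologicalGroupType} {R : realType} {d : measure_display}
  {X : measurableType d} {mu : probability X R} { pi : G -> X -> X}
  {alpha : set (set X)}.
Hypothesis hpi : measure_preserving_action mu pi.
Hypothesis halpha : finite_measurable_partition alpha.

Let L : finType := fset_set alpha.

Let alphaE A : (A \in fset_set alpha) = (A \in alpha).
Proof. by have [fin _ _] := halpha; rewrite in_fset_set. Qed.

Let alphaL (a : L) : alpha (val a).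
Proof. by have := valP a; rewrite alphaE inE. Qed.

Let pi_imageV g A : pi g^-1%g @` A = pi g @^-1` A.
Proof.
have [[pi1 piM] _ _ _] := hpi; apply/seteqP; split => x /=.
  by move=> [y Ay <-]; rewrite -piM mulgV pi1.
by move=> Ax; exists (pi g x) => //; rewrite -piM mulVg pi1.
Qed.

Let pi_preimage_measurable g A : measurable A -> measurable (pi g @^-1` A).
Proof.
by have [_ mpi _ _] := hpi => mA; rewrite -[X in measurable X]setTI; exact: mpi.
Qed.

(** The letters are the blocks of [alpha], and the atom of [w] consists of the points with itinerary
    [w] along [F]. Unlike the set [refined_partition], this indexing can repeat the empty atom. *)
Definition word_atom (F : {fset G}) (w : {ffun F -> L}) : set X :=
  \bigcap_(g in [set: F]) pi (val g) @^-1` val (w g).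

Lemma refined_partitionE (F : {fset G}) :
  refined_partition pi alpha F = range (@word_atom F).
Proof.
apply/seteqP; split => [_ [A aA <-]|_ [w _ <-]].
  have AL (g : F) : A (val g) \in fset_set alpha.
    by rewrite alphaE inE; apply: aA; exact: valP.
  exists [ffun g => [` AL g]%fset] => //; apply/seteqP; split => x h g.
    by move=> gF; rewrite pi_imageV; have := h [` gF]%fset I; rewrite /= ffunE.
  by move=> _; have := h _ (valP g); rewrite pi_imageV /= ffunE.
exists (fun g => oapp (fun g' : F => val (w g')) set0 (insub g)).
  by move=> g gF; rewrite insubT/=; exact: alphaL.
apply/seteqP; split => x h g.
  by move=> _; have := h (val g) (valP g); rewrite pi_imageV valK.
by move=> gF; rewrite pi_imageV insubT; exact: (h [` gF]%fset).
Qed.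

Lemma word_atom_measurable (F : {fset G}) (w : {ffun F -> L}) :
  measurable (word_atom w).
Proof.
apply: fin_bigcap_measurable => // g _; apply: pi_preimage_measurable.
by have [_ + _] := halpha; apply; exact: alphaL.
Qed.

Lemma word_atom_inj (F : {fset G}) (w w' : {ffun F -> L}) x :
  word_atom w x -> word_atom w' x -> w = w'.
Proof.
move=> wx w'x; apply/ffunP => g; apply: val_inj.
have [_ _ [_ tI _]] := halpha; apply: (tI _ _ (alphaL _) (alphaL _)).
by exists (pi (val g) x); split; [exact: wx|exact: w'x].
Qed.

Definition word_prob (F : {fset G}) (w : {ffun F -> L}) : R :=
  fine (mu (word_atom w)).

Lemma word_prob_ge0 (F : {fset G}) (w : {ffun F -> L}) : 0 <= word_prob w.
Proof. by rewrite fine_ge0. Qed.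

Lemma word_probE (F : {fset G}) (w : {ffun F -> L}) :
  (word_prob w)%:E = mu (word_atom w).
Proof. by rewrite fineK// fin_num_measure//; exact: word_atom_measurable. Qed.

Lemma sum_word_prob (F : {fset G}) (P : pred {ffun F -> L}) :
  (\sum_(w | P w) word_prob w)%:E = mu (\bigcup_(w in [set` P]) word_atom w).
Proof.
rewrite measure_fin_bigcup//.
- rewrite -sumEFin fsbig_finType.
  by apply: eq_bigr => w _; exact: word_probE.
- by move=> w w' _ _ [x [wx w'x]]; exact: word_atom_inj wx w'x.
- by move=> w _; exact: word_atom_measurable.
Qed.

Lemma sum_word_prob1 (F : {fset G}) :
  \sum_(w : {ffun F -> L}) word_prob w = 1.
Proof.
apply: EFin_inj; rewrite sum_word_prob -(probability_setT mu); congr (mu _).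
apply/seteqP; split => // x _.
have [_ _ [cov _ _]] := halpha.
have cv (g : F) : exists a : L, val a (pi (val g) x).
  have : [set: X] (pi (val g) x) by [].
  rewrite -cov => -[A aA Ax].
  by have AL : A \in fset_set alpha; [rewrite alphaE inE|exists [` AL]%fset].
have [f fP] := choice cv.
by exists [ffun g => f g] => // g _; rewrite /= ffunE; exact: fP.
Qed.

(** Atoms of positive measure are non-empty and so determine their words; words of probability 0
    contribute nothing to the sum on the right. *)
Lemma partition_entropy_refinedE (F : {fset G}) :
  partition_entropy mu (refined_partition pi alpha F) =
  - \sum_(w : {ffun F -> L}) word_prob w * ln (word_prob w).
Proof.
rewrite /partition_entropy refined_partitionE; congr (- _).
pose P := [pred w : {ffun F -> L} | 0 < word_prob w].
have -> : range (@word_atom F) `&` [set A | (0 < mu A)%E] =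
    (@word_atom F) @` [set` P].
  apply/seteqP; split => A.
    by move=> [[w _ <-]] /=; rewrite -word_probE lte_fin => w0; exists w.
  by move=> [w w0 <-]; split; [exists w|rewrite /= -word_probE lte_fin].
rewrite fsbig_image; last first.
  move=> w w' + _ e; rewrite inE/= => w0.
  have /set0P[x wx] : word_atom w != set0.
    by apply/eqP => we; move: (w0 : 0 < word_prob w); rewrite /word_prob we measure0 ltxx.
  by apply: (word_atom_inj wx); rewrite -e.
rewrite fsbig_finType [RHS](bigID P)/= [X in _ = _ + X]big1 ?addr0// => w.
rewrite -leNgt => w0; have -> : word_prob w = 0.
  by apply/eqP; rewrite eq_le w0 word_prob_ge0.
by rewrite mul0r.
Qed.

Lemma partition_entropy_refined_ge0 (F : {fset G}) :
  0 <= partition_entropy mu (refined_partition pi alpha F).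
Proof.
rewrite partition_entropy_refinedE oppr_ge0 sumr_le0// => w _.
rewrite mulr_ge0_le0 ?word_prob_ge0// ln_le0//.
by rewrite -lee_fin word_probE probability_le1//; exact: word_atom_measurable.
Qed.

(** On a mismatch the point lies in [g^-1.A] but not in [h^-1.A], where [A] is the letter at [g].
    Applying [g] preserves measure and carries this set into [A] minus [gh^-1.A]; summing over the
    blocks gives the factor [#|L|]. *)
Lemma word_mismatch_le (F : {fset G}) (g h : F) (theta : R) :
  (forall A, alpha A ->
    (mu (A `+` pi (val g * (val h)^-1)%g @` A) <= theta%:E)%E) ->
  \sum_(w : {ffun F -> L} | w g != w h) word_prob w <= theta *+ #|L|.
Proof.
move=> hA; have [fin ma [_ tI _]] := halpha.
have [[pi1 piM] _ mupi _] := hpi.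
rewrite -lee_fin sum_word_prob.
pose A_ (A : set X) := pi (val g) @^-1` A `\` pi (val h) @^-1` A.
have mA_ A : alpha A -> measurable (A_ A).
  by move=> aA; apply: measurableD; apply: pi_preimage_measurable; exact: ma.
apply: (@le_trans _ _ (\sum_(A \in alpha) mu (A_ A))%E).
  apply: content_sub_fsum => //.
    by apply: fin_bigcup_measurable => // w _; exact: word_atom_measurable.
  move=> x [w /= wgh wx]; exists (val (w g)); first exact: alphaL.
  split; first exact: wx.
  move=> wgx; move/eqP: wgh; apply; apply: val_inj.
  apply: (tI _ _ (alphaL _) (alphaL _)); exists (pi (val h) x); split=> //.
  exact: wx.
rewrite fsbig_finite//=.
apply: (@le_trans _ _ (\sum_(A <- fset_set alpha) theta%:E)%E).
  rewrite big_seq [leRHS]big_seq; apply: lee_sum => A; rewrite alphaE inE => aA.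
  have mA := ma _ aA.
  have mpiA : measurable (pi (val g * (val h)^-1)%g @` A).
    by rewrite -[X in pi X]invgK pi_imageV; exact: pi_preimage_measurable.
  apply: le_trans (hA _ aA); rewrite -(mupi (val g))//; last exact: mA_.
  apply: le_measure; rewrite ?inE.
  - by rewrite -[X in pi X]invgK pi_imageV; apply: pi_preimage_measurable; exact: mA_.
  - by apply: measurableU; exact: measurableD.
  move=> _ [x [Agx Ahx] <-]; left; split => //= -[y Ay].
  rewrite piM => e; apply: Ahx => /=.
  move/(congr1 (pi (val g)^-1%g)): e.
  rewrite -[LHS]piM -[RHS]piM mulVg !pi1 => <-.
  by rewrite -piM mulgV pi1.
by rewrite sumEFin big_const_seq count_predT iter_addr_0 cardfE.
Qed.

End RefinedPartition.

(** * Vanishing of the normalized entropy *)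

(** The mass [1 - expR (- eps)] left over by a correct letter is split equally into [k] shares. A
    small [eps] may force a large [lam], to be offset later by a small mismatch probability. *)
Lemma noisy_channel_cost (R : realType) (k : nat) (eps : R) :
  (0 < k)%N -> 0 < eps ->
  exists2 lam, 0 <= lam & expR (- eps) + k%:R * expR (- lam) <= 1.
Proof.
move=> k0 eps0; have e1 : expR (- eps) < 1 by rewrite -expR0 ltr_expR oppr_lt0.
have k1 : (1 : R) <= k%:R by rewrite ler1n.
have kx0 : 0 < (1 - expR (- eps)) / k%:R.
  by rewrite divr_gt0 ?subr_gt0// (lt_le_trans ltr01).
exists (- ln ((1 - expR (- eps)) / k%:R)).
  rewrite oppr_ge0 ln_le0// ler_pdivrMr ?(lt_le_trans ltr01)// mul1r.
  by apply: le_trans k1; rewrite lerBlDr lerDl expR_ge0.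
rewrite opprK lnK ?posrE// mulrC divfK; last by rewrite gt_eqF// (lt_le_trans ltr01).
by rewrite addrC subrK.
Qed.

Lemma normalized_entropy_le (G : topologicalGroupType) (R : realType)
    (d : measure_display) (X : measurableType d) (mu : probability X R)
    (pi : G -> X -> X) (alpha : set (set X)) (F C : {fset G})
    (W : set G) (eps lam theta delta : R) :
  measure_preserving_action mu pi -> finite_measurable_partition alpha ->
  F != fset0 -> (C `<=` F)%fset -> #|` C|%:R <= delta * #|` F|%:R ->
  (forall g, g \in F -> exists2 c, c \in C & W (g * c^-1)%g) ->
  (forall A u, alpha A -> W u -> (mu (A `+` pi u @` A) <= theta%:E)%E) ->
  (0 < #|` fset_set alpha|)%N -> 0 <= eps -> 0 <= lam ->
  expR (- eps) + #|` fset_set alpha|%:R * expR (- lam) <= 1 ->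
  normalized_entropy mu pi alpha F <=
    delta * ln #|` fset_set alpha|%:R + eps + lam * (theta *+ #|` fset_set alpha|).
Proof.
move=> hpi halpha F0 CF hC cov hW k0 eps0 lam0 hlam.
have F0' : (0 : R) < #|` F|%:R by rewrite ltr0n cardfs_gt0.
rewrite /normalized_entropy ler_pdivrMr// (partition_entropy_refinedE hpi)//.
have cv (g : F) : exists c : C, W (val g * (val c)^-1)%g.
  by have [c cC Wc] := cov _ (valP g); exists [` cC]%fset.
have [c cW] := choice cv.
(* The coarse word is the restriction to [C]: [s] is the inclusion, and [c] sends each point of [F]
   to a [W]-close point of [C]. *)
pose s (x : C) : F := [` fsubsetP CF _ (valP x)]%fset.
have := entropy_coding_bound c s (word_prob_ge0 (mu := mu) (pi := pi) (F := F))
  (sum_word_prob1 hpi halpha F) eps0.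
rewrite -!cardfE => /(_ lam k0 hlam)/le_trans; apply.
rewrite 2!mulrDl; apply: lerD; first apply: lerD.
- by rewrite mulrAC ler_wpM2r// ln_ge0// ler1n.
- by rewrite mulrC.
rewrite -mulrA ler_wpM2l// mulr_natr.
apply: (@le_trans _ _ (\sum_(g : F) theta *+ #|` fset_set alpha|)); last first.
  by rewrite sumr_const -cardfE.
apply: ler_sum => g _; rewrite [X in _ *+ X]cardfE.
apply: (word_mismatch_le hpi halpha) => A aA; apply: hW => //.
Qed.

(** The displacement of each block is continuous in [u] and vanishes at 1, and there are only
    finitely many blocks. *)
Lemma action_displacement_near (G : topologicalGroupType) (R : realType)
    (d : measure_display) (X : measurableType d) (mu : probability X R)
    (pi : G -> X -> X) (alpha : set (set X)) (theta : R) :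
  measure_preserving_action mu pi -> finite_measurable_partition alpha ->
  0 < theta ->
  \forall u \near (1%g : G), forall A, alpha A ->
    (mu (A `+` pi u @` A) <= theta%:E)%E.
Proof.
move=> [[pi1 _] _ _ ctpi] [fin ma _] theta0.
have h : nbhs (1%g : G) (\bigcap_(A in [set` fset_set alpha])
    [set u | (mu (A `+` pi u @` A) < theta%:E)%E]).
  apply: filter_bigI => A; rewrite in_fset_set// inE => aA.
  apply: (ctpi A (ma _ aA) 1%g [set y | (y < theta%:E)%E]).
  have -> : pi 1%g @` A = A by rewrite (_ : pi 1%g = id) ?image_id//; apply/funext.
  rewrite setYK measure0; apply: open_nbhs_nbhs; split; last by rewrite /= lte_fin.
  exact: open_ereal_lt_ereal.
apply: filterS h => u hu A aA; apply/ltW/hu.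
by rewrite /= in_fset_set// inE.
Qed.

Lemma normalized_entropy_cvg0 (R : realType) (G : topologicalGroupType)
    (hG : hausdorff_space G)
    (d : measure_display) (X : measurableType d) (mu : probability X R)
    (pi : G -> X -> X) (hpi : measure_preserving_action mu pi)
    (A : set G) (infA : infinite_set A) (preA : group_precompact A)
    (I : Type) (le : I -> I -> Prop) (F : I -> {fset G})
    (hF : thin_folner_net R le F) (alpha : set (set X)) :
  finite_measurable_partition alpha ->
  normalized_entropy mu pi alpha (F i) @[i --> tails le] --> (0 : R).
Proof.
move=> halpha; have [dle F0 _] := hF.
have ptails := tails_proper_filter dle.
(* An empty partition would cover only the empty set, whereas the space has measure 1. *)
have k0 : (0 < #|` fset_set alpha|)%N.
  rewrite cardfs_gt0; apply/eqP => /(congr1 (fun B : {fset set X} => [set` B])).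
  have [fin _ [cov _ _]] := halpha.
  rewrite fset_setK// set_fset0 => a0; move: cov; rewrite a0 /cover bigcup_set0.
  move/(congr1 mu); rewrite measure0 probability_setT => /eqP.
  by rewrite eq_sym onee_eq0.
set k := #|` fset_set alpha| in k0.
have k1 : (0 : R) < k%:R by rewrite ltr0n.
apply/cvgr0Pnorm_lt => e e0.
have e4 : 0 < e / 4 by rewrite divr_gt0.
have [lam lam0 hlam] := noisy_channel_cost k0 e4.
have lnk0 : 0 <= ln k%:R :> R by rewrite ln_ge0// ler1n.
(* [lam] depends on [e / 4], and [theta] on [lam]; each of the three error terms is then at most
   [e / 4]. The added 1 keeps the denominators positive, as [lam] and [ln k] may be 0. *)
pose theta := e / 4 / ((lam + 1) * k%:R).
pose delta := e / 4 / (ln k%:R + 1).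
have theta0 : 0 < theta by rewrite divr_gt0// mulr_gt0// ltr_wpDl.
have delta0 : 0 < delta by rewrite divr_gt0// ltr_wpDl.
pose W := [set u | forall B, alpha B -> (mu (B `+` pi u @` B) <= theta%:E)%E].
have W1 : nbhs (1%g : G) W := action_displacement_near hpi halpha theta0.
have := thin_folner_small_cover hG infA preA hF W1 delta0.
apply: filterS => i [C [CF cardC covC]].
rewrite ger0_norm; last first.
  by rewrite divr_ge0// (partition_entropy_refined_ge0 hpi).
apply: (@le_lt_trans _ _ (delta * ln k%:R + e / 4 + lam * (theta *+ k))).
  apply: (normalized_entropy_le hpi halpha (F0 i) CF cardC covC) => //.
    by move=> B u aB; exact.
  exact: ltW.
have h1 : delta * ln k%:R <= e / 4.
  by rewrite mulrAC ler_pdivrMr ?ltr_wpDl// ler_wpM2l ?(ltW e4)// lerDl.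
have h2 : lam * (theta *+ k) <= e / 4.
  have lam1 : 0 < lam + 1 by rewrite ltr_wpDl.
  have -> : lam * (theta *+ k) = e / 4 * lam / (lam + 1).
    by rewrite -mulr_natr /theta; field; rewrite !gt_eqF.
  by rewrite ler_pdivrMr// ler_wpM2l ?(ltW e4)// lerDl.
lra.
Qed.

Theorem corollary6p15 (R : realType) (G : topologicalGroupType)
    (hG : hausdorff_space G) (amG : amenable R G)
    (d : measure_display) (X : measurableType d) (mu : probability X R)
    (pi : G -> X -> X) (hpi : measure_preserving_action mu pi)
    (hA : exists A : set G, infinite_set A /\ group_precompact A)
    (I : Type) (le : I -> I -> Prop) (F : I -> {fset G})
    (hF : thin_folner_net R le F) :
  (forall alpha : set (set X), finite_measurable_partition alpha ->
     cvg (normalized_entropy mu pi alpha (F i) @[i --> tails le])) /\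
  ollagnier_entropy le F mu pi = 0%E.
Proof.
have [A [infA preA]] := hA; have [dle _ _] := hF.
have ptails := tails_proper_filter dle.
have cvg0 alpha (halpha : finite_measurable_partition alpha) :=
  normalized_entropy_cvg0 hG hpi infA preA hF halpha.
split=> [alpha /cvg0 h|]; first by apply/cvg_ex; exists 0.
rewrite /ollagnier_entropy (_ : [set _ | _ in _] = [set 0%E]) ?ereal_sup1//.
apply/seteqP; split => [_ [alpha /cvg0 h <-]|_ ->] /=.
  by rewrite (cvg_lim _ h).
(* All values are 0, but a supremum over no partition would be [-oo]; the trivial partition shows
   that the value 0 is attained. *)
have hT : finite_measurable_partition [set [set: X]].
  split; first exact: finite_set1.
    by move=> _ ->; exact: measurableT.
  split; first by rewrite /cover bigcup_set1.
    by move=> B B' -> ->.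
  move=> _ ->; apply/set0P/eqP => /(congr1 mu)/eqP.
  by rewrite measure0 probability_setT onee_eq0.
by exists [set [set: X]] => //; rewrite (cvg_lim _ (cvg0 _ hT)).
Qed.
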